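(* For all integers $n,k \geq 1$ and $i \geq 0$, the total number of vertices of outdegree $i$ among all $k$-ary trees with $n$ edges (that is, the number of pairs $(T,v)$ where $T$ is a $k$-ary tree with $n$ edges and $v$ is a vertex of $T$ of outdegree $i$) is $$\binom{k}{i}\binom{kn}{n-i}.$$
   Context: A $k$-ary tree is a nonempty finite rooted tree (with unlabelled vertices) in which every vertex has exactly $k$ ordered subtrees, each of which may be empty; i.e. each vertex has $k$ ordered slots, each slot being either empty or containing a nonempty $k$-ary subtree, and trees with different patterns of empty slots are different. A $k$-ary tree with $n$ edges has $n+1$ vertices. The outdegree of a vertex is the number of its nonempty subtrees (its children). The vertices of a given tree are counted as distinct positions in the tree. Convention: $\binom{a}{b}=0$ unless $0\le b\le a$. *)

(* Defs.v *)
From mathcomp Require Import all_boot.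
From mathcomp Require Import boolp classical_sets functions cardinality.

Set Implicit Arguments.
Unset Strict Implicit.
Unset Printing Implicit Defensive.

(* Content of a slot: empty, or a nonempty tree given by its own k slots.
   Slots are stored in a finite function, so that Leibniz equality is equality
   of trees. *)
Inductive slot (k : nat) : Type :=
  | Empty
  | Subtree of {ffun 'I_k -> slot k}.

Arguments Empty {k}.
Arguments Subtree {k} _.

(* A (nonempty) k-ary tree is its root, i.e. the contents of the k slots of its
   root. *)
Definition ktree (k : nat) : Type := {ffun 'I_k -> slot k}.

(* Edges contributed by a slot: if the slot is nonempty, the edge from its owner
   to the root of the subtree, and the edges of the subtree. *)
Fixpoint slot_edges (k : nat) (s : slot k) : nat :=
  if s is Subtree U then (\sum_(j < k) slot_edges (U j)).+1 else 0.

Definition nedges (k : nat) (T : ktree k) : nat :=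
  \sum_(j < k) slot_edges (T j).

(* Positions are addresses: the sequence of slots followed from the root. The
   result is [None] when the address leaves the tree. *)
Fixpoint subtree_at (k : nat) (T : ktree k) (v : seq 'I_k) : option (ktree k) :=
  if v is j :: w then
    if T j is Subtree U then subtree_at U w else None
  else Some T.

Definition is_vertex (k : nat) (T : ktree k) (v : seq 'I_k) : bool :=
  isSome (subtree_at T v).

(* The child of the vertex [v] in its slot [j], if any, has address
   [rcons v j]. *)
Definition outdegree (k : nat) (T : ktree k) (v : seq 'I_k) : nat :=
  #|[pred j : 'I_k | is_vertex T (rcons v j)]|.

(* Main.v *)
(* Cutting a pair (T, v) along the path from the root to v leaves the path, each
   step carrying the k - 1 side slots of a vertex, together with the k slots of
   v. Let N(q, m) count the pairs formed by such a path and q further slots,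
   with m edges in all. Looking whether the first of q + 1 slots is empty gives
   N(q+1, m) = N(q, m) + N(q+k, m-1), and removing the first step of a path gives
   N(0, m) = k N(k-1, m-1); Pascal's rule then yields N(q, m) = C(km+q, m).
   Requiring that i of the k slots of v be nonempty is handled by the same case
   distinction, slot by slot. *)
Require Import Defs.
From mathcomp Require Import all_boot.
From mathcomp Require Import finmap zify.
From mathcomp Require Import boolp classical_sets functions cardinality.

Local Open Scope nat_scope.
Local Open Scope classical_set_scope.
Local Open Scope card_scope.

(** * Cardinality of finite sets *)

Lemma card_disjoint_setU (T : Type) (A B : set T) (a b : nat) :
  A `&` B = set0 -> A #= `I_a -> B #= `I_b -> A `|` B #= `I_(a + b).
Proof.
(* Finite sets [{fset T}] live over a choice type, so [T] first receives a classical choice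
   structure. *)
elim/Pchoice: T => T in A B * => AB0 Aa Bb.
have fA : finite_set A by apply/finite_setP; exists a.
have fB : finite_set B by apply/finite_setP; exists b.
have fAB : finite_set (A `|` B) by rewrite finite_setU.
rewrite -(fset_setK fAB); apply/card_eq_fsetP.
rewrite fset_setU// cardfsU -fset_setI// AB0 fset_set0 cardfs0 subn0.
by rewrite (card_fset_set Aa) (card_fset_set Bb).
Qed.

Lemma card_image_II (T U : Type) (f : T -> U) (A : set T) (a : nat) :
  (forall x y, A x -> A y -> f x = f y -> x = y) ->
  A #= `I_a -> f @` A #= `I_a.
Proof.
move=> finj; apply: card_eq_trans; apply: inj_card_eq.
by move=> x y /set_mem Ax /set_mem Ay; apply: finj.
Qed.

Lemma card_labelled_copies (I : eqType) (T : Type) (r : seq I) (A : set T) (a : nat) :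
  uniq r -> A #= `I_a ->
  [set p : I * T | p.1 \in r /\ A p.2] #= `I_(size r * a).
Proof.
move=> + Aa; elim: r => [_|x r IH /= /andP[xr ur]].
  suff -> : [set p : I * T | p.1 \in [::] /\ A p.2] = set0 by rewrite mul0n II0.
  by apply/seteqP; split=> [p []|p].
have -> : [set p : I * T | p.1 \in x :: r /\ A p.2] =
    pair x @` A `|` [set p | p.1 \in r /\ A p.2].
  apply/seteqP; split=> [[y t] /= []|[y t] /= [[u Au [<- <-]]|[yr At]]].
  - by rewrite inE => /orP[/eqP-> At|yr At]; [left; exists t|right].
  - by rewrite mem_head.
  - by rewrite inE yr orbT.
rewrite mulSn; apply: card_disjoint_setU; last exact: IH.
- apply/seteqP; split=> // -[y t] /= [[u Au [<- _]] [xr']].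
  by rewrite xr' in xr.
- by apply: card_image_II Aa => y z _ _ [].
Qed.

(** * Slot sequences, paths and configurations *)

Section Configurations.

Set Implicit Arguments.
Unset Strict Implicit.

Context {k : nat}.

(** Inverse of [codom] on sequences of length [k], where the default is never read. *)
Definition tree_of_slots (s : seq (slot k)) : ktree k :=
  [ffun j : 'I_k => nth Defs.Empty s j].

Definition nonempty_slot (s : slot k) : bool :=
  if s is Subtree _ then true else false.

Definition slots_weight (s : seq (slot k)) : nat :=
  sumn (map (@slot_edges k) s).

Lemma codom_tree_of_slots (s : seq (slot k)) :
  size s = k -> codom (tree_of_slots s) = s.
Proof.
move=> ss; apply: (@eq_from_nth _ Defs.Empty); first by rewrite size_codom card_ord.
move=> l; rewrite size_codom card_ord => lk.
rewrite (nth_map (Ordinal lk)) ?size_enum_ord//.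
by rewrite ffunE -(nth_map _ 0) ?size_enum_ord// val_enum_ord nth_iota.
Qed.

Lemma tree_of_slotsK (T : ktree k) : tree_of_slots (codom T) = T.
Proof.
apply/ffunP => j; rewrite ffunE (nth_map j) ?size_enum_ord//.
by rewrite nth_ord_enum.
Qed.

Lemma nedges_codom (T : ktree k) : nedges T = slots_weight (codom T).
Proof.
rewrite /nedges /slots_weight sumnE big_map big_map.
by rewrite big_enum.
Qed.

Lemma slot_edges_tree (s : seq (slot k)) : size s = k ->
  slot_edges (Subtree (tree_of_slots s)) = (slots_weight s).+1.
Proof. by move=> ss; rewrite /= -/(nedges _) nedges_codom codom_tree_of_slots. Qed.

Lemma slots_weight_cons (x : slot k) (s : seq (slot k)) :
  slots_weight (x :: s) = slot_edges x + slots_weight s.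
Proof. by []. Qed.

Lemma slots_weight_cat (s t : seq (slot k)) :
  slots_weight (s ++ t) = slots_weight s + slots_weight t.
Proof. by rewrite /slots_weight map_cat sumn_cat. Qed.

(* The slot through which the path leaves a vertex, and its other slots. *)
Definition path_frame : Type := ('I_k * seq (slot k))%type.

Definition proper_path (p : seq path_frame) : bool :=
  all (fun y : path_frame => size y.2 == k.-1) p.

(** The successor counts the edge to the next vertex of the path. *)
Definition path_weight (p : seq path_frame) : nat :=
  sumn [seq (slots_weight x.2).+1 | x <- p].

Definition config : Type :=
  (seq path_frame * seq (slot k) * seq (slot k))%type.

(* A path, r slots of which i are nonempty (those of the pointed vertex), and q
   unrestricted slots, with m edges in total. *)
Definition configs (r i q m : nat) : set config :=
  [set x : config | [/\ proper_path x.1.1,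
     size x.1.2 = r, count nonempty_slot x.1.2 = i, size x.2 = q &
     path_weight x.1.1 + slots_weight x.1.2 + slots_weight x.2 = m]].

Definition put_empty_free (x : config) : config := (x.1, Defs.Empty :: x.2).

(** Reverses the opening of a nonempty free slot, which loses the edge above its subtree and frees
    the [k] slots of the subtree's root. *)
Definition put_tree_free (x : config) : config :=
  (x.1, Subtree (tree_of_slots (take k x.2)) :: drop k x.2).

Definition put_empty_fixed (x : config) : config := (x.1.1, Defs.Empty :: x.1.2, x.2).

Definition put_tree_fixed (x : config) : config :=
  (x.1.1, Subtree (tree_of_slots (take k x.2)) :: x.1.2, drop k x.2).

Definition push_frame (y : 'I_k * config) : config :=
  ((y.1, y.2.2) :: y.2.1.1, y.2.1.2, [::]).

(** The length bounds exclude padding by [Empty], so the tree determines the first [k] slots. *)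
Lemma tree_of_slots_take_inj (s t : seq (slot k)) :
  k <= size s -> k <= size t ->
  tree_of_slots (take k s) = tree_of_slots (take k t) -> drop k s = drop k t ->
  s = t.
Proof.
move=> ks kt /(congr1 (fun T : ktree k => codom T)).
rewrite !codom_tree_of_slots ?size_takel// => st dst.
by rewrite -(cat_take_drop k s) st dst cat_take_drop.
Qed.

Lemma slots_weight_take_drop (s : seq (slot k)) : k <= size s ->
  slots_weight (Subtree (tree_of_slots (take k s)) :: drop k s) =
  (slots_weight s).+1.
Proof.
move=> ks; rewrite slots_weight_cons slot_edges_tree ?size_takel//.
by rewrite addSn -slots_weight_cat cat_take_drop.
Qed.

Lemma slots_weight_codom_cat (U : ktree k) (s : seq (slot k)) :
  slots_weight (Subtree U :: s) = (slots_weight (codom U ++ s)).+1.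
Proof.
by rewrite slots_weight_cons slots_weight_cat -nedges_codom -addSn.
Qed.

Lemma take_codom_cat (U : ktree k) (s : seq (slot k)) :
  take k (codom U ++ s) = codom U.
Proof. by rewrite take_size_cat// size_codom card_ord. Qed.

Lemma drop_codom_cat (U : ktree k) (s : seq (slot k)) :
  drop k (codom U ++ s) = s.
Proof. by rewrite drop_size_cat// size_codom card_ord. Qed.

(** * Recurrences for configurations *)

Lemma configs_free (r i q m : nat) :
  configs r i q.+1 m = put_empty_free @` configs r i q m `|`
    (if m is m'.+1 then put_tree_free @` configs r i (q + k) m' else set0).
Proof.
apply/seteqP; split=> [[[p c] [|[|U] f]] [/= hp hc hi hq hm]|x].
- by [].
- by left; exists (p, c, f) => //; case: hq.
- case: hq => hq; right; case: m hm => [|m] hm; first by rewrite slots_weight_codom_cat in hm; lia.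
  exists (p, c, codom U ++ f); last first.
    by rewrite /put_tree_free/= take_codom_cat drop_codom_cat tree_of_slotsK.
  split=> //=; first by rewrite size_cat size_codom card_ord hq addnC.
  by move: hm; rewrite slots_weight_codom_cat; lia.
- case=> [[[[p c] f] [/= hp hc hi hq hm] <-]|]; first by split=> //=; rewrite hq.
  case: m => [//|m] [[[p c] f] [/= hp hc hi hq hm] <-].
  have kf : k <= size f by rewrite hq leq_addl.
  split=> //=; first by rewrite size_drop hq addnK.
  by rewrite slots_weight_take_drop//; lia.
Qed.

(** As for a free slot, except that opening a nonempty fixed slot also lowers [i]. The slots thus
    revealed lie below the pointed vertex, so they join the free ones. *)
Lemma configs_fixed (r i q m : nat) :
  configs r.+1 i q m = put_empty_fixed @` configs r i q m `|`
    (if (i, m) is (i'.+1, m'.+1)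
     then put_tree_fixed @` configs r i' (q + k) m' else set0).
Proof.
apply/seteqP; split=> [[[p [|[|U] c]] f] [/= hp hc hi hq hm]|x].
- by [].
- by left; exists (p, c, f) => //; case: hc.
- case: hc => hc; right; case: i hi => [//|i] [hi].
  case: m hm => [|m] hm; first by rewrite slots_weight_codom_cat in hm; lia.
  exists (p, c, codom U ++ f); last first.
    by rewrite /put_tree_fixed/= take_codom_cat drop_codom_cat tree_of_slotsK.
  split=> //=; first by rewrite size_cat size_codom card_ord hq addnC.
  by move: hm; rewrite slots_weight_codom_cat !slots_weight_cat; lia.
- case=> [[[[p c] f] [/= hp hc hi hq hm] <-]|]; first by split=> //=; rewrite ?hc.
  case: i => [//|i]; case: m => [//|m] [[[p c] f] [/= hp hc hi hq hm] <-].
  have kf : k <= size f by rewrite hq leq_addl.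
  split=> //=; rewrite ?hc ?hi//; first by rewrite size_drop hq addnK.
  by have := slots_weight_take_drop kf; rewrite !slots_weight_cons; lia.
Qed.

(** Without slots, a positive weight forces a first step; removing it loses one edge, frees its
    [k.-1] side slots and forgets one of [k] labels. *)
Lemma configs_push (m : nat) :
  configs 0 0 0 m.+1 =
  push_frame @` [set y | y.1 \in enum 'I_k /\ configs 0 0 k.-1 m y.2].
Proof.
apply/seteqP; split=> [[[[|[j s] p] [|? ?]] [|? ?]] [/= hp hc hi hq hm]|x] //.
  exists (j, (p, [::], s)) => //=; split; first by rewrite mem_enum.
  by case/andP: hp => /eqP hs hp; split=> //=; move: hm; rewrite /path_weight /slots_weight/=; lia.
case=> -[j [[p [|? ?]] s]] [/= _ [/= hp hc _ hs hm]] <- //.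
split=> //=; first by rewrite hs eqxx.
by move: hm; rewrite /path_weight /slots_weight/=; lia.
Qed.

Lemma configs_nil : configs 0 0 0 0 = [set ([::], [::], [::])].
Proof.
by apply/seteqP; split=> [[[[|[j s] p] [|? ?]] [|? ?]] [/= _ hc _ hq hm]|x ->] //.
Qed.

(** * Cardinality of the sets of configurations *)

Lemma put_empty_free_inj : injective put_empty_free.
Proof. by move=> [x f] [y g] [-> ->]. Qed.

Lemma put_empty_fixed_inj : injective put_empty_fixed.
Proof. by move=> [[p c] f] [[p' c'] f'] [-> -> ->]. Qed.

(** Induction on [m], then on [q]: both the removal of a step and the opening of a slot lower [m],
    while dropping an empty slot lowers [q]. *)
Lemma card_configs_free (q m : nat) : 0 < k ->
  configs 0 0 q m #= `I_'C(k * m + q, m).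
Proof.
move=> k_gt0; elim: m q => [|m IHm] q.
  elim: q => [|q IHq]; first by rewrite configs_nil bin0; apply: card_set1.
  rewrite configs_free setU0 bin0 -(bin0 (k * 0 + q)).
  by apply: card_image_II IHq => x y _ _ /put_empty_free_inj.
elim: q => [|q IHq].
  rewrite configs_push.
  (* Absorption identity (m+1) C(N, m+1) = N C(N-1, m) at N = k(m+1), with the common factor m+1
     cancelled. *)
  have -> : 'C(k * m.+1 + 0, m.+1) = size (enum 'I_k) * 'C(k * m + k.-1, m).
    rewrite size_enum_ord; apply/eqP; rewrite -(eqn_pmul2l (ltn0Sn m)) addn0.
    rewrite -mul_bin_diag mulnA (mulnC m.+1); apply/eqP; congr (_ * 'C(_, _)).
    by rewrite mulnS; lia.
  apply: card_image_II; last first.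
    by apply: card_labelled_copies; [exact: enum_uniq|exact: IHm].
  move=> [j [[p c] s]] [j' [[p' c'] s']] /= [_ _] [_ _].
  by case=> -> -> -> ->.
rewrite configs_free addnS binS; apply: card_disjoint_setU.
- by apply/seteqP; split=> // x [[y _ <-] [z _ []]].
- by apply: card_image_II IHq => x y _ _ /put_empty_free_inj.
(* One edge is traded for [k] slots, so both terms of Pascal's rule have the same upper index. *)
- have -> : k * m.+1 + q = k * m + (q + k) by rewrite mulnS; lia.
  apply: card_image_II (IHm _) => -[[p c] f] [[p' c'] f'].
  move=> [/= _ _ _ hf _] [/= _ _ _ hf' _].
  case=> -> -> ff' dff'; congr (_, _).
  by apply: tree_of_slots_take_inj => //; rewrite ?hf ?hf' leq_addl.
Qed.

(** Pascal's rule now acts on C(r, i): opening a slot changes neither km + q nor m - i. The test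
    [i <= m] guards against truncated subtraction, which would give C(km + q, 0) = 1. *)
Lemma card_configs (r i q m : nat) : 0 < k ->
  configs r i q m #=
  `I_('C(r, i) * (if i <= m then 'C(k * m + q, m - i) else 0)).
Proof.
move=> k_gt0; elim: r i q m => [|r IH] i q m.
  case: i => [|i]; first by rewrite mul1n subn0; apply: card_configs_free.
  suff -> : configs 0 i.+1 q m = set0 by rewrite mul0n II0.
  by apply/seteqP; split=> // -[[p [|? ?]] f] [].
have empty_part : put_empty_fixed @` configs r i q m #=
    `I_('C(r, i) * (if i <= m then 'C(k * m + q, m - i) else 0)).
  by apply: card_image_II (IH _ _ _) => x y _ _ /put_empty_fixed_inj.
rewrite configs_fixed; case: i empty_part => [|i] empty_part.
  by rewrite setU0 !bin0 in empty_part *.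
case: m empty_part => [|m] empty_part; first by rewrite setU0 !muln0 in empty_part *.
rewrite binS mulnDl; apply: card_disjoint_setU => //.
- by apply/seteqP; split=> // x [[y _ <-] [z _ []]].
- rewrite ltnS subSS.
  have -> : k * m.+1 + q = k * m + (q + k) by rewrite mulnS; lia.
  apply: card_image_II (IH _ _ _) => -[[p c] f] [[p' c'] f'].
  move=> [/= _ _ _ hf _] [/= _ _ _ hf' _].
  case=> -> ff' -> dff'; congr (_, _).
  by apply: tree_of_slots_take_inj => //; rewrite ?hf ?hf' leq_addl.
Qed.

(** * Cutting a tree along the path to a vertex, and regluing *)

Definition graft (j : 'I_k) (s : seq (slot k)) (U : ktree k) : ktree k :=
  tree_of_slots (take j s ++ Subtree U :: drop j s).

Lemma size_graft_slots (j : 'I_k) (s : seq (slot k)) (x : slot k) :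
  size s = k.-1 -> size (take j s ++ x :: drop j s) = k.
Proof.
move=> hs; rewrite size_cat /= addnS -size_cat cat_take_drop hs prednK//.
(* The existence of [j] makes [k] positive. *)
exact: leq_ltn_trans (ltn_ord j).
Qed.

Lemma size_take_ord (j : 'I_k) (s : seq (slot k)) :
  size s = k.-1 -> size (take j s) = j.
Proof. by move=> hs; rewrite size_takel// hs; have := ltn_ord j; lia. Qed.

Lemma graft_at (j : 'I_k) (s : seq (slot k)) (U : ktree k) :
  size s = k.-1 -> graft j s U j = Subtree U.
Proof. by move=> hs; rewrite ffunE nth_cat size_take_ord// ltnn subnn. Qed.

Lemma nedges_graft (j : 'I_k) (s : seq (slot k)) (U : ktree k) :
  size s = k.-1 -> nedges (graft j s U) = slots_weight s + (nedges U).+1.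
Proof.
move=> hs; rewrite nedges_codom codom_tree_of_slots ?size_graft_slots//.
rewrite slots_weight_cat slots_weight_cons -[in RHS](cat_take_drop j s).
by rewrite slots_weight_cat addnA addnAC.
Qed.

Lemma graft_inj (j : 'I_k) (s t : seq (slot k)) (U V : ktree k) :
  size s = k.-1 -> size t = k.-1 -> graft j s U = graft j t V ->
  s = t /\ U = V.
Proof.
move=> hs ht /(congr1 (fun T : ktree k => codom T)).
rewrite !codom_tree_of_slots ?size_graft_slots// => e.
have := congr1 (take j) e; have := congr1 (drop j) e.
rewrite !take_size_cat ?drop_size_cat ?size_take_ord// => -[-> ed] et.
by rewrite -(cat_take_drop j s) et ed cat_take_drop.
Qed.

Lemma graft_surj (j : 'I_k) (T U : ktree k) : T j = Subtree U ->
  exists2 s : seq (slot k), size s = k.-1 & graft j s U = T.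
Proof.
move=> TjU; pose t : seq (slot k) := codom T.
have ht : size t = k by rewrite size_codom card_ord.
have jt : j < size t by rewrite ht.
have htj : size (take j t) = j by rewrite size_takel// ltnW.
(* The side slots are those of [T] with the [j]-th deleted. *)
exists (take j t ++ drop j.+1 t).
  by rewrite size_cat htj size_drop ht; have := ltn_ord j; lia.
rewrite /graft take_size_cat// drop_size_cat// -[RHS]tree_of_slotsK -TjU.
have -> : T j = nth Defs.Empty t j.
  by rewrite (nth_map j) ?size_enum_ord// nth_ord_enum.
by rewrite -drop_nth// cat_take_drop.
Qed.

Lemma outdegree_root (T : ktree k) :
  outdegree T [::] = count nonempty_slot (codom T).
Proof.
rewrite /outdegree count_map -sum1_count big_enum_cond /= sum1_card.
by apply: eq_card => j; rewrite [RHS]unfold_in !inE /is_vertex/=; case: (T j).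
Qed.

Lemma outdegree_cons (T U : ktree k) (j : 'I_k) (v : seq 'I_k) :
  T j = Subtree U -> outdegree T (j :: v) = outdegree U v.
Proof. by move=> e; apply: eq_card => l; rewrite !inE /is_vertex/= e. Qed.

(** Inverse of the cutting: rebuilds the tree from the pointed vertex upwards, and reads its address
    off the labels of the path. *)
Fixpoint plug (p : seq path_frame) (c : seq (slot k)) : ktree k * seq 'I_k :=
  if p is (j, s) :: p' then
    let: (U, v) := plug p' c in (graft j s U, j :: v)
  else (tree_of_slots c, [::]).

Lemma plug_spec (p : seq path_frame) (c : seq (slot k)) :
  proper_path p -> size c = k ->
  [/\ nedges (plug p c).1 = path_weight p + slots_weight c,
      is_vertex (plug p c).1 (plug p c).2 &
      outdegree (plug p c).1 (plug p c).2 = count nonempty_slot c].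
Proof.
move=> + hc; elim: p => [_|[j s] p IH /= /andP[/eqP hs /IH]].
  by split; rewrite //= ?outdegree_root ?nedges_codom codom_tree_of_slots.
case: (plug p c) => U v /= [eU vU dU].
have gU : graft j s U j = Subtree U by apply: graft_at.
split; last by rewrite (outdegree_cons _ gU).
  by rewrite nedges_graft// eU /path_weight/=; lia.
by rewrite /is_vertex /= gU.
Qed.

(** The address fixes the length and the labels of the path; [graft_inj] then recovers the side
    slots step by step. *)
Lemma plug_inj (p p' : seq path_frame) (c c' : seq (slot k)) :
  proper_path p -> proper_path p' -> size c = k -> size c' = k ->
  plug p c = plug p' c' -> p = p' /\ c = c'.
Proof.
move=> + + hc hc'.
elim: p p' => [|[j s] p IH] [|[j' s'] p'] /=.
- move=> _ _ [/(congr1 (fun T : ktree k => codom T))].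
  by rewrite !codom_tree_of_slots.
- by case: (plug p' c').
- by case: (plug p c).
- move=> /andP[/eqP hs hp] /andP[/eqP hs' hp'].
  case E: (plug p c) => [U v]; case E': (plug p' c') => [U' v'] [].
  move=> + jj' vv'; rewrite -jj' => /(graft_inj hs hs')[-> UU'].
  by have [|-> ->] := IH p' hp hp'; rewrite // E E' UU' vv'.
Qed.

Lemma plug_surj (T : ktree k) (v : seq 'I_k) : is_vertex T v ->
  exists p c, [/\ proper_path p, size c = k & plug p c = (T, v)].
Proof.
elim: v T => [|j v IH] T.
  exists [::], (codom T); split; rewrite ?size_codom ?card_ord//=.
  by rewrite tree_of_slotsK.
rewrite /is_vertex/=; case E: (T j) => [//|U] /IH[p [c [hp hc e]]].
have [s hs g] := graft_surj E.
by exists ((j, s) :: p), c; split; rewrite //= ?hs ?eqxx// e g.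
Qed.

End Configurations.

Theorem theorem3 (n k i : nat) (hn : 1 <= n) (hk : 1 <= k) :
  [set p : ktree k * seq 'I_k |
     [/\ nedges p.1 = n, is_vertex p.1 p.2 & outdegree p.1 p.2 = i]]
  #= `I_('C(k, i) * (if i <= n then 'C(k * n, n - i) else 0)).
Proof.
(* With [q = 0] the free part is forced to be [[::]], so ignoring it keeps the map injective. *)
have -> : [set p : ktree k * seq 'I_k |
     [/\ nedges p.1 = n, is_vertex p.1 p.2 & outdegree p.1 p.2 = i]] =
  (fun x : config => plug x.1.1 x.1.2) @` configs k i 0 n.
  apply/seteqP; split=> [[T v] /= [eT vT dT]|_ [[[p c] f] [/= hp hc hi hf hm] <-]].
    have [p [c [hp hc e]]] := plug_surj vT.
    have := plug_spec hp hc; rewrite e /= => -[eT' _ dT'].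
    exists (p, c, [::]) => //; split=> //=; rewrite -?dT' // -?eT eT'.
    by rewrite /slots_weight/= addn0.
  have [eT vT dT] := plug_spec hp hc.
  split=> //; last by rewrite dT.
  by rewrite eT -hm (size0nil hf) /slots_weight/= addn0.
apply: card_image_II; last by rewrite -[k * n]addn0; apply: card_configs.
move=> [[p c] f] [[p' c'] f'] [/= hp hc _ hf _] [/= hp' hc' _ hf' _] e.
have [-> ->] := plug_inj hp hp' hc hc' e.
by rewrite (size0nil hf) (size0nil hf').
Qed.
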